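(* Let $(M,\varphi,\xi,\eta,g)$ be a $(2n+1)$-dimensional almost contact B-metric manifold whose Reeb vector field $\xi$ is torse-forming with function $f$. Let $a,b,c,\lambda,\mu,\nu$ be real constants. Provided that $f$ is a constant and $$a+\lambda+f=0,\qquad b+\mu=0,\qquad c+\nu-f=0,$$ the manifold admits a Ricci-like soliton with potential $\xi$ and constants $(\lambda,\mu,\nu)$ if and only if the manifold is Einstein-like with constants $(a,b,c)$. In particular (with $f$ constant and the constants related by the equalities above): (i) The manifold admits an $\eta$-Ricci soliton with potential $\xi$ and constants $(\lambda,\nu)$ if and only if the manifold is $\eta$-Einstein with constants $(a,c)$, where the equality $a+c+\lambda+\nu=0$ is valid. (ii) The manifold admits a Ricci soliton with potential $\xi$ and constant $\lambda$ if and only if the manifold is $\eta$-Einstein with constants $(-\lambda-f,f)$. (iii) The manifold is Einstein with constant $a$ if and only if it admits an $\eta$-Ricci soliton with potential $\xi$ and constants $(-a-f,f)$.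
   Context: An almost contact B-metric manifold $(M,\varphi,\xi,\eta,g)$ is a smooth manifold of dimension $2n+1$ ($n\ge 1$) with an endomorphism $\varphi$ of $TM$, a (Reeb) vector field $\xi$, a 1-form $\eta$ and a pseudo-Riemannian metric $g$ of signature $(n+1,n)$ such that $\varphi\xi=0$, $\varphi^2=-\mathrm{id}+\eta\otimes\xi$, $\eta\circ\varphi=0$, $\eta(\xi)=1$, and $g(\varphi x,\varphi y)=-g(x,y)+\eta(x)\eta(y)$. The associated metric is $\tilde g(x,y)=g(x,\varphi y)+\eta(x)\eta(y)$. Here $x,y$ are arbitrary vector fields, $\nabla$ is the Levi-Civita connection of $g$, $R(x,y)z=\nabla_x\nabla_yz-\nabla_y\nabla_xz-\nabla_{[x,y]}z$, and $\rho(y,z)$ is the Ricci tensor of $g$, i.e. the trace of $x\mapsto R(x,y)z$. $\xi$ is torse-forming with function $f$ if $\nabla_x\xi=f\,x+\alpha(x)\xi$ for a smooth function $f$ and a 1-form $\alpha$; since $\eta(\nabla_x\xi)=0$, this means $\alpha=-f\eta$ and $\nabla_x\xi=-f\varphi^2x$. It is assumed throughout that $f$ is not identically zero. The manifold is Einstein-like with constants $(a,b,c)$ if $\rho=a\,g+b\,\tilde g+c\,\eta\otimes\eta$ with $a,b,c$ real constants; $\eta$-Einstein with constants $(a,c)$ if this holds with $b=0$; Einstein with constant $a$ if this holds with $b=c=0$. With $\mathcal L$ the Lie derivative, the manifold admits a Ricci-like soliton with potential $\xi$ and (real) constants $(\lambda,\mu,\nu)$ if $\frac12\mathcal L_\xi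 g+\rho+\lambda g+\mu\tilde g+\nu\,\eta\otimes\eta=0$; an $\eta$-Ricci soliton with potential $\xi$ and constants $(\lambda,\nu)$ if this holds with $\mu=0$; a Ricci soliton with potential $\xi$ and constant $\lambda$ if this holds with $\mu=\nu=0$. *)

(* Defs.v *)
From HB Require Import structures.
From mathcomp Require Import all_boot all_order all_algebra.
From mathcomp Require Import ring.
From mathcomp Require Import all_classical all_reals.
From mathcomp Require Import topology normedtype derive.
Set Implicit Arguments.
Unset Strict Implicit.
Unset Printing Implicit Defensive.
Import Order.TTheory GRing.Theory Num.Theory.
Import numFieldTopology.Exports numFieldNormedType.Exports.
Local Open Scope classical_set_scope.
Local Open Scope ring_scope.

Section SmoothEuclidean.
Context {R : realType} {m : nat}.
Implicit Types (U : set 'rV[R]_m) (h : 'rV[R]_m -> R).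

(* h has continuous iterated partial derivatives up to order k at the points
   of U; only used for U open *)
Fixpoint Ck (k : nat) U h : Prop :=
  (forall x, U x -> {for x, continuous h}) /\
  if k is k'.+1 then
    forall i : 'I_m, (forall x, U x -> derivable h x (delta_mx 0 i)) /\
                     Ck k' U (fun x => 'D_(delta_mx 0 i) h x)
  else True.

Definition smooth_on U h := forall k, Ck k U h.

Lemma Ck_continuous k U h : Ck k U h -> forall x, U x -> {for x, continuous h}.
Proof. by case: k => [|k] []. Qed.

Lemma Ck_ext k U h1 h2 : open U -> (forall x, U x -> h1 x = h2 x) ->
  Ck k U h1 -> Ck k U h2.
Proof.
move=> oU.
have nbhsE h h' x : (forall x, U x -> h x = h' x) -> U x -> \near x, h x = h' x.
  move=> e Ux; have : \near x, U x by apply: open_nbhs_nbhs.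
  by apply: filterS => y /e.
have cE h h' : (forall x, U x -> h x = h' x) ->
    (forall x, U x -> {for x, continuous h}) ->
    forall x, U x -> {for x, continuous h'}.
  move=> e c x Ux; rewrite /prop_for /continuous_at -(e x)//.
  apply: cvg_trans (c x Ux); apply: (@near_eq_cvg _ _ (nbhs x)).
  exact: (nbhsE h h').
elim: k h1 h2 => [|k IH] h1 h2 e [c1 D1]; split => //; try exact: cE c1.
move=> i; have [d1 C1] := D1 i; split.
  by move=> x Ux; apply: near_eq_derivable (d1 x Ux); exact: (nbhsE h1 h2).
apply: IH C1 => x Ux; apply: near_eq_derive; exact: (nbhsE h1 h2).
Qed.

Lemma CkS k U h : Ck k.+1 U h -> Ck k U h.
Proof.
elim: k h => [|k IH] h [c D]; split=> // i.
by have [d C] := D i; split => //; apply: IH.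
Qed.

Lemma Ck_cst k U (c : R) : Ck k U (cst c).
Proof.
elim: k c => [|k IH] c; split=> //; try by move=> x _; exact: cst_continuous.
move=> i; split; first by move=> x _; exact: derivable_cst.
have -> : (fun x => 'D_(delta_mx 0 i) (cst c : 'rV[R]_m -> R) x) = cst 0.
  by apply/funext => x; rewrite derive_cst.
exact: IH.
Qed.

Lemma CkD k U h1 h2 : open U -> Ck k U h1 -> Ck k U h2 -> Ck k U (h1 + h2).
Proof.
move=> oU; elim: k h1 h2 => [|k IH] h1 h2 [c1 D1] [c2 D2]; split=> //;
  try by move=> x Ux; apply: continuousD; [exact: c1|exact: c2].
move=> i; have [d1 C1] := D1 i; have [d2 C2] := D2 i; split.
  by move=> x Ux; apply: derivableD; [exact: d1|exact: d2].
apply: Ck_ext oU _ (IH _ _ C1 C2) => x Ux.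
by rewrite deriveD; [|exact: d1|exact: d2].
Qed.

Lemma CkM k U h1 h2 : open U -> Ck k U h1 -> Ck k U h2 -> Ck k U (h1 * h2).
Proof.
move=> oU; elim: k h1 h2 => [|k IH] h1 h2 H1 H2; split=> //;
  have c1 := Ck_continuous H1; have c2 := Ck_continuous H2;
  try by move=> x Ux; apply: continuousM; [exact: c1|exact: c2].
move: (H1) (H2) => [_ D1] [_ D2].
move=> i; have [d1 C1] := D1 i; have [d2 C2] := D2 i; split.
  by move=> x Ux; apply: derivableM; [exact: d1|exact: d2].
apply: Ck_ext oU _
  (CkD oU (IH _ _ (CkS H1) C2) (IH _ _ (CkS H2) C1)) => x Ux.
by rewrite deriveM; [|exact: d1|exact: d2].
Qed.

End SmoothEuclidean.

(* [param] is the inverse of [coord] on [dom]; values elsewhere are irrelevant *)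
Record chart (R : realType) (m : nat) (M : topologicalType) := Chart {
  dom : set M;
  coord : M -> 'rV[R]_m;
  param : 'rV[R]_m -> M;
  dom_open : open dom;
  codom_open : open (coord @` dom);
  coord_continuous : forall p, dom p -> {for p, continuous coord};
  param_continuous : forall x, (coord @` dom) x -> {for x, continuous param};
  coordK : forall p, dom p -> param (coord p) = p }.

Record smoothManifold (R : realType) (m : nat) := SmoothManifold {
  space :> topologicalType;
  space_hausdorff : hausdorff_space space;
  space_second_countable : second_countable (T := space);
  atlas : set (chart R m space);
  atlas_cover : forall p, exists2 c, atlas c & dom c p;
  atlas_compat : forall c c', atlas c -> atlas c' -> forall i : 'I_m,
    smooth_on (coord c @` (dom c `&` dom c'))
              (fun x => coord c' (param c x) 0 i) }.

Section SmoothFunctions.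
Context {R : realType} {m : nat} (M : smoothManifold R m).

Definition smooth (f : M -> R) := forall c, atlas c ->
  smooth_on (coord c @` dom c) (f \o param c).

Definition smooth_pred : {pred M -> R} := fun f => `[< smooth f >].

Lemma smooth_cst (a : R) : smooth (cst a).
Proof. by move=> c _ k; exact: Ck_cst. Qed.

Lemma smoothD (f g : M -> R) : smooth f -> smooth g -> smooth (f + g).
Proof.
by move=> sf sg c Ac k; apply: CkD (sf c Ac k) (sg c Ac k); exact: codom_open.
Qed.

Lemma smoothM (f g : M -> R) : smooth f -> smooth g -> smooth (f * g).
Proof.
by move=> sf sg c Ac k; apply: CkM (sf c Ac k) (sg c Ac k); exact: codom_open.
Qed.

Lemma smoothN (f : M -> R) : smooth f -> smooth (- f).
Proof.
move=> sf; have -> : - f = cst (-1) * f.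
  by apply/funext => p; rewrite -[LHS]mulN1r.
exact: smoothM (smooth_cst _) sf.
Qed.

Fact smooth_subring : subring_closed smooth_pred.
Proof.
split=> [|f g /asboolP sf /asboolP sg|f g /asboolP sf /asboolP sg]; apply/asboolP.
- exact: smooth_cst.
- exact: smoothD sf (smoothN sg).
- exact: smoothM.
Qed.

HB.instance Definition _ :=
  GRing.isSubringClosed.Build (M -> R) smooth_pred smooth_subring.

(* the algebra of smooth functions; R embeds as the constants [cfun a] *)
Record sfun := SFun { sfun_val :> M -> R; _ : sfun_val \in smooth_pred }.
HB.instance Definition _ := [isSub for sfun_val].
HB.instance Definition _ := [Choice of sfun by <:].
HB.instance Definition _ := GRing.SubChoice_isSubComPzRing.Build
  (M -> R) smooth_pred sfun smooth_subring.

Definition mk_sfun f (sf : smooth f) : sfun := SFun (asboolT sf).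
Definition cfun (a : R) : sfun := mk_sfun (smooth_cst a).

Lemma sfun_smooth (f : sfun) : smooth f.
Proof. by case: f => f /= /asboolP. Qed.

(* the R-linear derivations of the smooth functions at p *)
Definition derivation_at (p : M) (v : sfun -> R^o) : Prop :=
  [/\ forall f g : sfun, v (f + g) = v f + v g,
      forall (a : R) (f : sfun), v (cfun a * f) = a * v f
    & forall f g : sfun, v (f * g) = f p * v g + g p * v f].

Definition derivation_pred p : {pred sfun -> R^o} :=
  fun v => `[< derivation_at p v >].

Fact derivation_submod p : submod_closed (derivation_pred p).
Proof.
split=> [|a u v /asboolP[uD uZ uM] /asboolP[vD vZ vM]]; apply/asboolP.
  have E h : (0 : sfun -> R^o) h = 0 :> R by [].
  by split=> *; rewrite !E ?(mulr0, addr0).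
have E h : (a *: u + v) h = a * u h + v h :> R by [].
split.
- move=> f g; rewrite !E uD vD; ring.
- move=> b f; rewrite !E uZ vZ; ring.
- move=> f g; rewrite !E uM vM; ring.
Qed.

HB.instance Definition _ p := GRing.isSubmodClosed.Build R (sfun -> R^o)
  (derivation_pred p) (derivation_submod p).

Record tangent (p : M) :=
  Tangent { tangent_val :> sfun -> R^o; _ : tangent_val \in derivation_pred p }.
HB.instance Definition _ p := [isSub for @tangent_val p].
HB.instance Definition _ p := [Choice of tangent p by <:].
HB.instance Definition _ p := [SubChoice_isSubLmodule of tangent p by <:].

End SmoothFunctions.

Section VectorFields.
Context {R : realType} {m : nat} {M : smoothManifold R m}.

(* [vf_at X p f] is the derivative of f at p in the direction X p *)
Definition vf_at (X : forall p : M, tangent p) (f : sfun M) : M -> R :=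
  fun p => X p f.

Record vfield := VField {
  vf :> forall p : M, tangent p;
  vf_smooth : forall f : sfun M, smooth (vf_at vf f) }.

Definition vderiv (X : vfield) (f : sfun M) : sfun M := mk_sfun (vf_smooth X f).

Lemma sfunP (f g : sfun M) : (forall p, f p = g p) -> f = g.
Proof. by move=> fg; apply/val_inj/funext. Qed.

Lemma tangentP (p : M) (u v : tangent p) : (forall f, u f = v f) -> u = v.
Proof. by move=> uv; apply/val_inj/funext. Qed.

Lemma tangent_der (p : M) (v : tangent p) : derivation_at p v.
Proof. by case: v => v /= /asboolP. Qed.

Lemma vfieldP (X Y : vfield) : (forall p, X p = Y p) -> X = Y.
Proof.
case: X Y => [X sX] [Y sY] /= e; have {}e : X = Y by apply: functional_extensionality_dep.
by case: _ / e in sY *; congr VField; exact: Prop_irrelevance.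
Qed.

Fact vf_zero_smooth (f : sfun M) : smooth (vf_at (fun p => 0) f).
Proof.
by have -> : vf_at (fun p => 0) f = cst 0 by []; exact: smooth_cst.
Qed.
Definition vf_zero := VField vf_zero_smooth.

Fact vf_opp_smooth (X : vfield) (f : sfun M) :
  smooth (vf_at (fun p => - X p) f).
Proof. exact: smoothN (vf_smooth X f). Qed.
Definition vf_opp X := VField (vf_opp_smooth X).

Fact vf_add_smooth (X Y : vfield) (f : sfun M) :
  smooth (vf_at (fun p => X p + Y p) f).
Proof. exact: smoothD (vf_smooth X f) (vf_smooth Y f). Qed.
Definition vf_add X Y := VField (vf_add_smooth X Y).

Fact vf_scale_smooth (h : sfun M) (X : vfield) (f : sfun M) :
  smooth (vf_at (fun p => h p *: X p) f).
Proof. exact: smoothM (sfun_smooth h) (vf_smooth X f). Qed.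
Definition vf_scale h X := VField (vf_scale_smooth h X).

HB.instance Definition _ := gen_eqMixin vfield.
HB.instance Definition _ := gen_choiceMixin vfield.

Fact vf_addA : associative vf_add.
Proof. by move=> X Y Z; apply: vfieldP => p; exact: addrA. Qed.
Fact vf_addC : commutative vf_add.
Proof. by move=> X Y; apply: vfieldP => p; exact: addrC. Qed.
Fact vf_add0 : left_id vf_zero vf_add.
Proof. by move=> X; apply: vfieldP => p; exact: add0r. Qed.
Fact vf_addN : left_inverse vf_zero vf_opp vf_add.
Proof. by move=> X; apply: vfieldP => p; exact: addNr. Qed.

HB.instance Definition _ :=
  GRing.isZmodule.Build vfield vf_addA vf_addC vf_add0 vf_addN.

Fact vf_scaleA (f g : sfun M) X : vf_scale f (vf_scale g X) = vf_scale (f * g) X.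
Proof. by apply: vfieldP => p; exact: scalerA. Qed.
Fact vf_scale1 : left_id 1 vf_scale.
Proof. by move=> X; apply: vfieldP => p; exact: scale1r. Qed.
Fact vf_scaleDr : right_distributive vf_scale +%R.
Proof. by move=> f X Y; apply: vfieldP => p; exact: scalerDr. Qed.
Fact vf_scaleDl X : {morph vf_scale^~ X : f g / f + g}.
Proof. by move=> f g; apply: vfieldP => p; exact: scalerDl. Qed.

(* vector fields form a module over the smooth functions *)
HB.instance Definition _ := GRing.Zmodule_isLmodule.Build (sfun M) vfield
  vf_scaleA vf_scale1 vf_scaleDr vf_scaleDl.

Definition bracket_fun (X Y : vfield) (p : M) (f : sfun M) : R^o :=
  X p (vderiv Y f) - Y p (vderiv X f).

Fact bracket_der X Y p : bracket_fun X Y p \in derivation_pred p.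
Proof.
have D Z (f g : sfun M) : vderiv Z (f + g) = vderiv Z f + vderiv Z g.
  by apply: sfunP => q; have [h _ _] := tangent_der (Z q); exact: h.
have S Z a (f : sfun M) : vderiv Z (cfun M a * f) = cfun M a * vderiv Z f.
  by apply: sfunP => q; have [_ h _] := tangent_der (Z q); exact: h.
have L Z (f g : sfun M) : vderiv Z (f * g) = f * vderiv Z g + g * vderiv Z f.
  by apply: sfunP => q; have [_ _ h] := tangent_der (Z q); exact: h.
have [XD XZ XM] := tangent_der (X p); have [YD YZ YM] := tangent_der (Y p).
apply/asboolP; rewrite /bracket_fun; split.
- by move=> f g; rewrite !D XD YD; ring.
- by move=> a f; rewrite !S XZ YZ; ring.
- have E Z (h : sfun M) : vderiv Z h p = Z p h by [].
  by move=> f g; rewrite !L XD YD !XM !YM !E; ring.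
Qed.

Fact bracket_smooth X Y (f : sfun M) :
  smooth (vf_at (fun p => Tangent (bracket_der X Y p)) f).
Proof.
exact: smoothD (vf_smooth X (vderiv Y f)) (smoothN (vf_smooth Y (vderiv X f))).
Qed.

Definition bracket X Y : vfield := VField (bracket_smooth X Y).

(* smooth sections of End(TM), of the cotangent bundle, and of its square *)
Record endo_field := EndoField {
  endo :> forall p : M, {linear tangent p -> tangent p};
  endo_smooth : forall (X : vfield) f, smooth (vf_at (fun p => endo p (X p)) f) }.

Record one_form := OneForm {
  form :> forall p : M, {scalar tangent p};
  form_smooth : forall X : vfield, smooth (fun p => form p (X p)) }.

Record bilin_field := BilinField {
  bilin :> forall p : M, tangent p -> tangent p -> R;
  bilin_linearl : forall p v, scalar (fun u : tangent p => bilin u v);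
  bilin_linearr : forall p (u : tangent p), scalar (bilin u);
  bilin_smooth : forall X Y : vfield, smooth (fun p => bilin (X p) (Y p)) }.

Definition endo_app (phi : endo_field) (X : vfield) : vfield :=
  VField (endo_smooth phi X).
Definition form_app (eta : one_form) (X : vfield) : sfun M :=
  mk_sfun (form_smooth eta X).
Definition bilin_app (g : bilin_field) (X Y : vfield) : sfun M :=
  mk_sfun (bilin_smooth g X Y).

End VectorFields.
Arguments vfield {R m} M.
Arguments endo_field {R m} M.
Arguments one_form {R m} M.
Arguments bilin_field {R m} M.

Definition is_basis (R : realType) (V : lmodType R) (m : nat) (e : 'I_m -> V) :=
  forall v, exists! c : 'rV[R]_m, v = \sum_i c 0 i *: e i.

(* the trace of an endomorphism L of a space of dimension m *)
Definition trace (R : realType) (V : lmodType R) (m : nat) (L : V -> V) : R :=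
  xget 0 [set t | exists e : 'I_m -> V, is_basis e /\
    exists2 A : 'M[R]_m, (forall j, L (e j) = \sum_i A i j *: e i) & t = \tr A].

Section Geometry.
Context {R : realType} {m : nat} {M : smoothManifold R m}.
Implicit Types (X Y Z : vfield M) (g : bilin_field M).

(* pseudo-Riemannian of signature (r, s), where r + s = m; nondegeneracy is
   part of the second condition *)
Definition pseudo_riemannian (r s : nat) g :=
  (forall p u v, g p u v = g p v u) /\
  (forall p, exists e : 'I_(r + s) -> tangent p, is_basis e /\
     forall i j, g p (e i) (e j) =
       if i == j then if (i < r)%N then 1 else -1 else 0).

Definition connection (nabla : vfield M -> vfield M -> vfield M) :=
  [/\ forall Y, linear (nabla ^~ Y),
      forall X Y Z, nabla X (Y + Z) = nabla X Y + nabla X Z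
    & forall X f Y, nabla X (f *: Y) = vderiv X f *: Y + f *: nabla X Y].

Definition levi_civita g nabla :=
  [/\ connection nabla,
      forall X Y, nabla X Y - nabla Y X = bracket X Y
    & forall X Y Z, vderiv X (bilin_app g Y Z) =
        bilin_app g (nabla X Y) Z + bilin_app g Y (nabla X Z)].

Definition curvature (nabla : vfield M -> vfield M -> vfield M) X Y Z :=
  nabla X (nabla Y Z) - nabla Y (nabla X Z) - nabla (bracket X Y) Z.

(* a vector field with value v at p; those exist by means of bump functions *)
Definition extension (p : M) (v : tangent p) : vfield M :=
  xget 0 [set X : vfield M | X p = v].

(* the trace at p of x |-> R(x, Y)Z, whose value at p depends on x p only *)
Definition ricci nabla Y Z (p : M) : R :=
  trace m (fun v : tangent p => curvature nabla (extension v) Y Z p).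

(* (L_X g)(Y, Z), by the Leibniz rule, where L_X Y = [X, Y] *)
Definition lie_bilin X g Y Z : sfun M :=
  vderiv X (bilin_app g Y Z) - bilin_app g (bracket X Y) Z
  - bilin_app g Y (bracket X Z).

Definition torse_forming nabla (xi : vfield M) (f : sfun M) :=
  exists alpha : one_form M,
    forall X, nabla X xi = f *: X + form_app alpha X *: xi.

End Geometry.

Record acB_manifold (R : realType) (n : nat) := ACBManifold {
  acB_space :> smoothManifold R (n.+1 + n);
  phi : endo_field acB_space;
  xi : vfield acB_space;
  eta : one_form acB_space;
  metric : bilin_field acB_space;
  metric_signature : pseudo_riemannian n.+1 n metric;
  phi_xi : forall p, phi p (xi p) = 0;
  phi_phi : forall (p : acB_space) (x : tangent p), phi p (phi p x) = - x + eta p x *: xi p;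
  eta_phi : forall (p : acB_space) (x : tangent p), eta p (phi p x) = 0;
  eta_xi : forall p, eta p (xi p) = 1;
  metric_phi : forall (p : acB_space) (x y : tangent p),
    metric p (phi p x) (phi p y) = - metric p x y + eta p x * eta p y }.

Section BMetric.
Context {R : realType} {n : nat} (M : acB_manifold R n).
Implicit Types nabla : vfield M -> vfield M -> vfield M.

Definition assoc_metric (p : M) (x y : tangent p) : R :=
  metric M p x (phi M p y) + eta M p x * eta M p y.

Definition einstein_like nabla (a b c : R) := forall (x y : vfield M) (p : M),
  ricci nabla x y p = a * metric M p (x p) (y p)
    + b * assoc_metric (x p) (y p) + c * (eta M p (x p) * eta M p (y p)).

Definition eta_einstein nabla a c := einstein_like nabla a 0 c.
Definition einstein nabla a := einstein_like nabla a 0 0.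

Definition ricci_like_soliton nabla (lambda mu nu : R) :=
  forall (x y : vfield M) (p : M),
    2^-1 * lie_bilin (xi M) (metric M) x y p + ricci nabla x y p
    + lambda * metric M p (x p) (y p) + mu * assoc_metric (x p) (y p)
    + nu * (eta M p (x p) * eta M p (y p)) = 0.

Definition eta_ricci_soliton nabla lambda nu :=
  ricci_like_soliton nabla lambda 0 nu.
Definition ricci_soliton nabla lambda := ricci_like_soliton nabla lambda 0 0.

End BMetric.
Arguments einstein_like {R n} M.
Arguments eta_einstein {R n} M.
Arguments einstein {R n} M.
Arguments ricci_like_soliton {R n} M.
Arguments eta_ricci_soliton {R n} M.
Arguments ricci_soliton {R n} M.

(* Main.v *)
Require Import Defs.
From mathcomp Require Import all_boot all_order all_algebra.
From mathcomp Require Import ring lra.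
From mathcomp Require Import all_classical all_reals.
From mathcomp Require Import topology.
Import GRing.Theory.
Local Open Scope ring_scope.

(** The Ricci tensor is the same on both sides of each equivalence, so only the
    Lie derivative of the metric has to be computed. The Levi-Civita properties
    turn it into (L_xi g)(Y, Z) = g(nabla_Y xi, Z) + g(Y, nabla_Z xi)
    ([lie_bilinE]). The field xi has constant length 1 and is g-dual to eta, so
    nabla_Y xi is orthogonal to xi; this forces the 1-form of the torse-forming
    condition to be - f eta ([torse_forming_formE]). Hence
    (1/2) L_xi g = f (g - eta (x) eta) ([half_lie_metricE]).

    When f is a constant k, the soliton equation therefore reads
    rho = - (lambda + k) g - mu g~ - (nu - k) eta (x) eta, which is the
    Einstein-like equation whose constants are the ones related to
    (lambda, mu, nu) in the theorem ([soliton_einstein_like]). The three special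
    cases are obtained by choosing which of the constants vanish. *)

Section Bilinear.
Context {R : realType} {m : nat} {M : smoothManifold R m}.
Variable g : bilin_field M.

Lemma bilinDl p (u v w : tangent p) : g p (u + v) w = g p u w + g p v w.
Proof. by have := bilin_linearl g w 1 u v; rewrite scale1r mul1r. Qed.

Lemma bilinDr p (u v w : tangent p) : g p u (v + w) = g p u v + g p u w.
Proof. by have := bilin_linearr g u 1 v w; rewrite scale1r mul1r. Qed.

Lemma bilin0l p (w : tangent p) : g p 0 w = 0.
Proof. by apply: (@addIr _ (g p 0 w)); rewrite -bilinDl add0r add0r. Qed.

Lemma bilin0r p (u : tangent p) : g p u 0 = 0.
Proof. by apply: (@addIr _ (g p u 0)); rewrite -bilinDr add0r add0r. Qed.

Lemma bilinZl p a (u w : tangent p) : g p (a *: u) w = a * g p u w.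
Proof. by have := bilin_linearl g w a u 0; rewrite bilin0l !addr0. Qed.

Lemma bilinZr p a (u w : tangent p) : g p u (a *: w) = a * g p u w.
Proof. by have := bilin_linearr g u a w 0; rewrite bilin0r !addr0. Qed.

Lemma bilinBl p (u v w : tangent p) : g p (u - v) w = g p u w - g p v w.
Proof. by rewrite bilinDl -scaleN1r bilinZl mulN1r. Qed.

Lemma bilinBr p (u v w : tangent p) : g p u (v - w) = g p u v - g p u w.
Proof. by rewrite bilinDr -scaleN1r bilinZr mulN1r. Qed.

End Bilinear.

Section Connection.
Context {R : realType} {m : nat} {M : smoothManifold R m}.
Variables (g : bilin_field M) (nabla : vfield M -> vfield M -> vfield M).
Hypothesis nablaP : levi_civita g nabla.

(** Compatibility with g expands X g(Y, Z), and the absence of torsion rewrites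
    the brackets; the terms in nabla_X cancel. *)
Lemma lie_bilinE (X Y Z : vfield M) p :
  lie_bilin X g Y Z p = g p (nabla Y X p) (Z p) + g p (Y p) (nabla Z X p).
Proof.
case: nablaP => _ torsion compat.
rewrite /lie_bilin compat -!torsion.
(* The module operations on vector fields and functions are pointwise by
   definition; here and below, [change] passes to the values at p. *)
change (g p (nabla X Y p) (Z p) + g p (Y p) (nabla X Z p)
  - g p (nabla X Y p - nabla Y X p) (Z p)
  - g p (Y p) (nabla X Z p - nabla Z X p)
  = g p (nabla Y X p) (Z p) + g p (Y p) (nabla Z X p)).
by rewrite bilinBl bilinBr; ring.
Qed.

Lemma vderiv1 (X : vfield M) p : vderiv X 1 p = 0.
Proof.
have [_ _ leibniz] := tangent_der (X p).
have := leibniz 1 1; rewrite mulr1 => H.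
change (X p 1 = 0 :> R); change (X p 1 = 1 * X p 1 + 1 * X p 1 :> R) in H.
by lra.
Qed.

(** Differentiate g(Y, Y) = 1 along X: by symmetry of g this gives
    2 g(nabla_X Y, Y) = 0. *)
Lemma unit_field_derivative_orthogonal (X Y : vfield M) p :
  (forall p (u v : tangent p), g p u v = g p v u) ->
  (forall p, g p (Y p) (Y p) = 1) -> g p (nabla X Y p) (Y p) = 0.
Proof.
case: nablaP => _ _ compat sym unitY.
have Y1 : bilin_app g Y Y = 1 by apply: sfunP => q; exact: unitY.
have := congr1 (fun h : sfun M => h p) (compat X Y Y).
rewrite Y1 vderiv1 => H.
change (0 = g p (nabla X Y p) (Y p) + g p (Y p) (nabla X Y p)) in H.
by rewrite (sym _ (Y p)) in H; lra.
Qed.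

End Connection.

Section BMetric.
Context {R : realType} {n : nat} (M : acB_manifold R n).
Variables (nabla : vfield M -> vfield M -> vfield M) (f : sfun M).
Hypothesis nablaP : levi_civita (metric M) nabla.

Lemma metricC p (u v : tangent p) : metric M p u v = metric M p v u.
Proof. by case: (metric_signature M) => sym _; exact: sym. Qed.

(** The compatibility of the metric with phi, applied to x and xi, gives this
    because phi xi = 0. *)
Lemma metric_xi p (x : tangent p) : metric M p x (xi M p) = eta M p x.
Proof.
have := metric_phi x (xi M p); rewrite phi_xi bilin0r eta_xi mulr1 => H.
by lra.
Qed.

(** Pair nabla_X xi = f X + alpha(X) xi with the unit field xi, to which
    nabla_X xi is orthogonal. *)
Lemma torse_forming_formE (alpha : one_form M) :
  (forall X, nabla X (xi M) = f *: X + form_app alpha X *: xi M) ->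
  forall (X : vfield M) p, alpha p (X p) = - (f p * eta M p (X p)).
Proof.
move=> nablaE X p.
have xi1 q : metric M q (xi M q) (xi M q) = 1 by rewrite metric_xi eta_xi.
have := unit_field_derivative_orthogonal _ _ nablaP X _ p metricC xi1.
rewrite nablaE => H.
change (metric M p (f p *: X p + alpha p (X p) *: xi M p) (xi M p) = 0) in H.
by rewrite bilinDl !bilinZl xi1 metric_xi in H; lra.
Qed.

Lemma half_lie_metricE (Y Z : vfield M) p : torse_forming nabla (xi M) f ->
  2^-1 * lie_bilin (xi M) (metric M) Y Z p =
  f p * (metric M p (Y p) (Z p) - eta M p (Y p) * eta M p (Z p)).
Proof.
move=> [alpha nablaE]; have alphaE := torse_forming_formE _ nablaE.
rewrite (lie_bilinE _ _ nablaP) !nablaE.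
change (2^-1 * (metric M p (f p *: Y p + alpha p (Y p) *: xi M p) (Z p)
  + metric M p (Y p) (f p *: Z p + alpha p (Z p) *: xi M p))
  = f p * (metric M p (Y p) (Z p) - eta M p (Y p) * eta M p (Z p))).
rewrite bilinDl bilinDr !bilinZl !bilinZr !alphaE (metricC _ (xi M p)) !metric_xi.
by field.
Qed.

Lemma soliton_einstein_like k a b c lambda mu nu :
  torse_forming nabla (xi M) f -> (forall p, f p = k) ->
  a + lambda + k = 0 -> b + mu = 0 -> c + nu - k = 0 ->
  ricci_like_soliton M nabla lambda mu nu <-> einstein_like M nabla a b c.
Proof.
move=> xi_tf fk akl bmu cnu.
have -> : lambda = - a - k by lra.
have -> : mu = - b by lra.
have -> : nu = k - c by lra.
split=> H x y p; have := H x y p; rewrite half_lie_metricE // fk => {}H.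
  by apply/eqP; rewrite -subr_eq0; apply/eqP; rewrite -[RHS]H; ring.
by rewrite H; ring.
Qed.

End BMetric.

Theorem theorem3p6 (R : realType) (n : nat) (n_gt0 : (0 < n)%N)
    (M : acB_manifold R n)
    (nabla : vfield M -> vfield M -> vfield M)
    (nablaP : levi_civita (metric M) nabla)
    (f : sfun M) (f_neq0 : exists p : M, f p != 0)
    (xi_torse_forming : torse_forming nabla (xi M) f)
    (k : R) (f_const : forall p : M, f p = k) :
  (forall a b c lambda mu nu : R,
     a + lambda + k = 0 -> b + mu = 0 -> c + nu - k = 0 ->
     (ricci_like_soliton M nabla lambda mu nu <-> einstein_like M nabla a b c))
  /\ (forall a c lambda nu : R,
        a + lambda + k = 0 -> c + nu - k = 0 ->
        (eta_ricci_soliton M nabla lambda nu <-> eta_einstein M nabla a c)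
        /\ a + c + lambda + nu = 0)
  /\ (forall lambda : R,
        ricci_soliton M nabla lambda <-> eta_einstein M nabla (- lambda - k) k)
  /\ (forall a : R,
        einstein M nabla a <-> eta_ricci_soliton M nabla (- a - k) k).
Proof.
have equiv a b c lambda mu nu := soliton_einstein_like M nabla f nablaP k
  a b c lambda mu nu xi_torse_forming f_const.
split; first exact: equiv.
split; [|split].
- move=> a c lambda nu akl cnu; split; last by lra.
  by apply: equiv => //; lra.
- by move=> lambda; apply: equiv; lra.
- by move=> a; apply: iff_sym; apply: equiv; lra.
Qed.
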